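(* In the radio network model with known topology (even without collision detection), there is a randomized distributed algorithm that broadcasts $k$ messages from the source to all nodes in $O(D + k\log n + \log^2 n)$ rounds, with high probability.
   Context: Radio network model: the network is a connected undirected graph $G=(V,E)$ with $n$ nodes, operating in synchronous rounds. In each round each node either transmits a packet of $B=\Omega(\log n)$ bits or listens. A listening node $v$ receives a packet only if exactly one of its neighbors transmits in that round; if two or more neighbors transmit, $v$ receives nothing (no collision detection is needed for this result). $k$-message broadcast: a designated source node $s$ holds $k$ messages, each of at most $\Theta(B)$ bits, which must all be delivered to every node. $D$ denotes the diameter of $G$. Known topology: every node knows the whole graph $G$. ''With high probability'' means with probability at least $1-1/n^{c}$ for a constant $c\ge 1$. *)

(* Defs.v *)
From HB Require Import structures.
From mathcomp Require Import all_boot all_order all_algebra.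
From mathcomp Require Import reals exp.

Set Implicit Arguments.
Unset Strict Implicit.
Unset Printing Implicit Defensive.

Import Order.TTheory GRing.Theory Num.Theory.

Record graph (n : nat) := Graph {
  adj :> rel 'I_n;
  adj_sym : symmetric adj;
  adj_irrefl : irreflexive adj
}.

Definition connected n (G : graph n) : Prop := forall u v, connect G u v.

Definition walk n (G : graph n) (d : nat) (u v : 'I_n) : bool :=
  [exists p : d.-tuple 'I_n, path G u p && (last u p == v)].

(* In a connected graph some walk from u to v has length < n, so the default
   value n is never reached. *)
Definition dist n (G : graph n) (u v : 'I_n) : nat :=
  \big[minn/n]_(d < n | walk G d u v) d.

Definition diameter n (G : graph n) : nat := \max_u \max_v dist G u v.

Notation packet B := (B.-tuple bool).
Notation message := (seq bool).

(* What a node hears in one round; None is both silence and collision, since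
   there is no collision detection. *)
Notation reception B := (option (packet B)).

(* The action of a node in a round depends only on its identity, its input
   (the k messages at the source, None elsewhere), its private coins and what
   it has heard in all earlier rounds; the round number is the size of this
   history. The action None means listening. *)
Record protocol (n k B : nat) := Protocol {
  rounds : nat;
  coins : nat;
  act : 'I_n -> option (k.-tuple message) -> coins.-tuple bool ->
        seq (reception B) -> option (packet B);
  output : 'I_n -> option (k.-tuple message) -> coins.-tuple bool ->
           seq (reception B) -> k.-tuple message
}.

(* Known topology: the code run by the nodes may depend on the whole graph, as
   well as on the designated source, k and B. *)
Definition algorithm : Type :=
  forall n (G : graph n) (s : 'I_n) (k B : nat), protocol n k B.

(* A transmitting node hears nothing; a listening one hears a packet iff exactly
   one neighbor transmits. *)
Definition receive n (G : graph n) B (x : 'I_n -> option (packet B))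
    (v : 'I_n) : reception B :=
  if x v is Some _ then None
  else if [seq u <- enum 'I_n | G v u && isSome (x u)] is [:: u] then x u
  else None.

Definition input n k (s : 'I_n) (m : k.-tuple message) (v : 'I_n) :=
  if v == s then Some m else None.

Definition coin_space n k B (P : protocol n k B) : finType :=
  {ffun 'I_n -> (coins P).-tuple bool}.

Fixpoint history n k B (G : graph n) (s : 'I_n) (P : protocol n k B)
    (m : k.-tuple message) (w : coin_space P) (t : nat) :
    'I_n -> seq (reception B) :=
  if t is t'.+1 then
    let h := history G s m w t' in
    let x u := act u (input s m u) (w u) (h u) in
    fun v => rcons (h v) (receive G x v)
  else fun=> [::].

Definition delivered n k B (G : graph n) (s : 'I_n) (P : protocol n k B)
    (m : k.-tuple message) (w : coin_space P) : bool :=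
  [forall v, output v (input s m v) (w v) (history G s m w (rounds P) v) == m].

(* All coins of all nodes are independent and fair, i.e. the joint coin
   assignment is uniform. *)
Definition success_probability (R : realType) n k B (G : graph n) (s : 'I_n)
    (P : protocol n k B) (m : k.-tuple message) : R :=
  (#|[set w : coin_space P | delivered G s m w]|%:R / #|coin_space P|%:R)%R.

(* Main.v *)
Require Import Defs.
From HB Require Import structures.
From mathcomp Require Import all_boot all_order all_algebra.
From mathcomp Require Import boolp reals exp.
From mathcomp Require Import zify ring lra.

Set Implicit Arguments.
Unset Strict Implicit.
Unset Printing Implicit Defensive.

Import Order.TTheory GRing.Theory Num.Theory.

(** By the probabilistic method it suffices to find, for a known topology, a
fixed schedule of transmissions and a fixed coding scheme under which every
node can tell apart any two message vectors: no coins are then needed.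

In a ranked BFS tree (a "gathering spanning tree") every root path has
logarithmically many rank changes, and edges between equal ranks carry waves
without collisions: in even rounds a packet emitted by the head of such a
stretch travels one level every two rounds.  In odd rounds the nodes transmit
with probability 2^-i for a random i (as in Decay), separated by their
distance modulo 3 in the virtual graph where stretches are contracted; a node
then hears some node closer to the source with probability of order 1/log n.
Every non-forwarded bit is a random function of what its sender knows, so it
separates two vectors known to be different with probability 1/2.

For a fixed pair of vectors, the probability that v cannot separate them
obeys a linear recursion in time, with the supersolution 2^d (1 - e)^x, where
d is the virtual distance of v, e is of order 1/log n and x is the time
elapsed after round 2 (level + d).  A union bound over nodes and pairs
concludes. *)

(** * Ranked breadth-first trees *)

Section Hops.
Variables (T : finType) (e : rel T) (s : T).

Fixpoint within i v : bool :=
  if i is j.+1 then within j v || [exists u, within j u && e u v] else v == s.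

(* The default value #|T| is only reached at vertices not connected to s. *)
Definition hops v : nat := find (within^~ v) (iota 0 #|T|).

Lemma hops_le_within i v : within i v -> hops v <= i.
Proof.
move=> wiv; rewrite leqNgt; apply/negP => lt_i.
have ltiT : i < #|T|.
  by apply: leq_trans lt_i _; rewrite -[X in _ <= X](size_iota 0) find_size.
by have := before_find 0 lt_i; rewrite nth_iota // wiv.
Qed.

Lemma within_path p : path e s p -> within (size p) (last s p).
Proof.
elim/last_ind: p => [|p v IHp]; first by rewrite /= eqxx.
rewrite rcons_path last_rcons size_rcons => /andP[/IHp wp ev] /=.
by apply/orP; right; apply/existsP; exists (last s p); rewrite wp.
Qed.

Lemma hops_root : hops s = 0.
Proof. by apply/eqP; rewrite -leqn0 hops_le_within //= eqxx. Qed.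

Hypothesis conn : forall v, connect e s v.

Lemma within_hops v : within (hops v) v.
Proof.
have /connectP[p0 e_p0 vE] := conn v.
move: e_p0 vE => /shortenP[p e_p Up _ vE].
have ltp : size p < #|T|.
  by have := max_card (mem (s :: p)); rewrite (card_uniqP Up).
have hs : has (within^~ v) (iota 0 #|T|).
  apply/hasP; exists (size p); first by rewrite mem_iota.
  by rewrite vE within_path.
by have := nth_find 0 hs; rewrite nth_iota // -[X in _ < X](size_iota 0) -has_find.
Qed.

Lemma hops_eq0 v : (hops v == 0) = (v == s).
Proof.
apply/idP/idP => [/eqP h0|/eqP->]; last by rewrite hops_root.
by have := within_hops v; rewrite h0.
Qed.

Lemma hops_edge u v : e u v -> hops v <= (hops u).+1.
Proof.
move=> euv; apply: hops_le_within => /=; apply/orP; right.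
by apply/existsP; exists u; rewrite within_hops.
Qed.

Lemma hops_pred v : v != s -> exists2 u, e u v & hops v = (hops u).+1.
Proof.
rewrite -hops_eq0; case E: (hops v) => [//|j] _.
have := within_hops v; rewrite E /= => /orP[/hops_le_within|].
  by rewrite E ltnn.
case/existsP => u /andP[/hops_le_within ule euv]; exists u => //.
by have := hops_edge euv; rewrite E; lia.
Qed.

End Hops.

(** Walks witness [within], and the default [n] of [dist] is itself an upper bound for [hops]. *)
Lemma hops_le_diameter n (G : graph n) (s v : 'I_n) :
  hops G s v <= diameter G.
Proof.
apply: (@leq_trans (dist G s v)).
  rewrite /dist; apply: (big_ind (fun x => hops G s v <= x)).
  - by rewrite -[X in _ <= X]card_ord -[X in _ <= X](size_iota 0) find_size.
  - by move=> x y hx hy; rewrite leq_min hx.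
  move=> d /existsP[p /andP[pp /eqP <-]].
  by rewrite -[X in _ <= X](size_tuple p); apply: hops_le_within; apply: within_path.
apply: leq_trans (@leq_bigmax _ (fun u => \max_w dist G u w) s).
exact: (@leq_bigmax _ (dist G s) v).
Qed.

(* The grouping f with the largest domain: two ungrouped vertices of equal
   rank with a common neighbor could be added to it. *)
Lemma maximal_grouping (T : finType) (X : {set T}) (e : rel T) (rk : T -> nat) :
  exists f : {ffun T -> option T},
  [/\ forall x y, f x = Some y -> x \in X /\ e y x,
      forall x y, f x = Some y ->
        exists2 x', x' != x & f x' = Some y /\ rk x' = rk x
    & forall x x' y, x \in X -> x' \in X -> f x = None -> f x' = None ->
        rk x = rk x' -> e y x -> e y x' -> x = x'].
Proof.
pose ok (f : {ffun T -> option T}) := [forall x, forall y, (f x == Some y) ==>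
  [&& x \in X, e y x
    & [exists x', [&& x' != x, f x' == Some y & rk x' == rk x]]]].
have ok0 : ok [ffun=> None] by apply/forallP=> x; apply/forallP=> y; rewrite ffunE.
have [f okf fmax] := @arg_maxnP _ [ffun=> None] ok (fun f => #|[set x | f x]|) ok0.
exists f; split.
- move=> x y fx; have /forallP/(_ x)/forallP/(_ y) := okf.
  by rewrite fx eqxx => /and3P[].
- move=> x y fx; have /forallP/(_ x)/forallP/(_ y) := okf.
  rewrite fx eqxx => /and3P[_ _ /existsP[x' /and3P[? /eqP ? /eqP ?]]].
  by exists x'.
move=> x x' y xX x'X fx fx' rkE eyx eyx'; apply/eqP/negPn/negP => xx'.
pose f' := [ffun z => if (z == x) || (z == x') then Some y else f z].
suff okf' : ok f'.
  have /= := fmax _ okf'; rewrite leqNgt => /negP; apply.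
  apply: proper_card; apply/properP; split.
    by apply/subsetP => z; rewrite !inE ffunE; case: ifP.
  by exists x; rewrite !inE ?ffunE ?eqxx ?fx.
apply/forallP => z; apply/forallP => y'; apply/implyP; rewrite ffunE.
case: ifP => [zxx' /eqP[<-{y'}]|/norP[zx zx'] /eqP fz].
  case/orP: zxx' => /eqP->; rewrite ?xX ?x'X ?eyx ?eyx' /=; apply/existsP.
    by exists x'; rewrite eq_sym xx' ffunE eqxx orbT eqxx rkE eqxx.
  by exists x; rewrite xx' ffunE eqxx rkE !eqxx.
have /forallP/(_ z)/forallP/(_ y') := okf.
rewrite fz eqxx => /and3P[-> -> /existsP[z' /and3P[z'z /eqP fz' rkz']]] /=.
apply/existsP; exists z'; rewrite z'z rkz' ffunE.
case: ifP; last by rewrite fz' eqxx.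
by case/orP=> /eqP z'E; rewrite z'E ?fx ?fx' in fz'.
Qed.

Section GatheringTree.
Variables (n : nat) (G : graph n) (s : 'I_n).
Hypothesis conn : connected G.
Let lev := hops G s.

(* The ranked BFS tree ("gathering spanning tree") of Gasieniec, Peleg and
   Xin, restricted to the edges whose lower endpoint is below level j. *)
Definition ranked_below j (par : 'I_n -> 'I_n) (rk : 'I_n -> nat) : Prop :=
  [/\ forall v, j < lev v -> G (par v) v /\ lev v = (lev (par v)).+1,
      forall v, j < lev v -> rk v <= rk (par v),
      forall v w, j < lev v -> lev v = lev w -> rk v = rk w ->
        rk (par v) = rk v -> rk (par w) = rk w -> G (par w) v -> v = w
    & forall i, j <= i ->
        \sum_(v | lev v == i) 2 ^ rk v <= #|[set v | i <= lev v]|].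

(** Vertices of level [j + 1] grouped by [f] hang below their chosen common neighbor, the others
    below any neighbor one level up. A parent's rank is the maximum of its children's ranks, grouped
    children counting one more. An equal-rank edge thus has an ungrouped lower end, and maximality
    of the grouping excludes collisions. A raised rank is paid for by two children of equal rank,
    which preserves the bound on the sum of [2 ^ rk]. *)
Lemma ranked_below_step j par rk : ranked_below j.+1 par rk ->
  exists par' rk', ranked_below j par' rk'.
Proof.
case=> [Hadj Hrk Hcol Hsum].
have [f [fX fpair fmax]] := maximal_grouping
  [set v | lev v == j.+1] (fun y x => G y x && (lev x == (lev y).+1)) rk.
have pre v : exists u, (v != s) ==> (G u v && (lev v == (lev u).+1)).
  have [->|vs] := eqVneq v s; first by exists s.
  by have [u Guv E] := hops_pred (conn s) vs; exists u; rewrite Guv /lev E eqxx.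
pose p0 v := xchoose (pre v).
pose par' v := if lev v == j.+1 then odflt (p0 v) (f v) else par v.
pose kid y x := (lev x == j.+1) && (par' x == y).
pose rk' y := if lev y == j then \max_(x | kid y x) (rk x + f x) else rk y.
have par'P v : j < lev v -> G (par' v) v /\ lev v = (lev (par' v)).+1.
  move=> jv; rewrite /par'; case: eqP => [vj|/eqP vj]; last first.
    by apply: Hadj; rewrite ltn_neqAle eq_sym vj.
  case fv: (f v) => [y|] /=; first by have [_ /andP[? /eqP ?]] := fX _ _ fv.
  have vs : v != s by rewrite -(hops_eq0 (conn s)) -/lev vj.
  by have /implyP/(_ vs)/andP[? /eqP] := xchooseP (pre v).
have rk'E v : j < lev v -> rk' v = rk v.
  by rewrite /rk'; case: eqP => // ->; rewrite ltnn.
have par'E v : j.+1 < lev v -> par' v = par v.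
  by rewrite /par'; case: eqP => // ->; rewrite ltnn.
have rk'kid v : lev v = j.+1 -> rk v + f v <= rk' (par' v).
  move=> vj; have [|_] := par'P v; rewrite vj // => -[lE].
  rewrite /rk' -lE eqxx; apply: (@leq_bigmax_cond _ (kid (par' v)) (fun x => rk x + f x)).
  by rewrite /kid vj !eqxx.
exists par', rk'; split=> //.
- move=> v jv; rewrite rk'E //.
  have [vj|vj] := eqVneq (lev v) j.+1.
    by apply: leq_trans (rk'kid _ vj); rewrite leq_addr.
  have jv' : j.+1 < lev v by rewrite ltn_neqAle eq_sym vj.
  rewrite par'E // rk'E ?Hrk //.
  by have [_] := Hadj _ jv'; lia.
- move=> v w jv vw; have jw : j < lev w by rewrite -vw.
  rewrite !(rk'E v) // !(rk'E w) //.
  have [vj|vj] := eqVneq (lev v) j.+1; last first.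
    have jv' : j.+1 < lev v by rewrite ltn_neqAle eq_sym vj.
    have jw' : j.+1 < lev w by rewrite -vw.
    have [_ ?] := Hadj _ jv'; have [_ ?] := Hadj _ jw'.
    by rewrite !par'E // !rk'E; [exact: Hcol|lia|lia].
  move=> rkE rkv rkw Gwv.
  have := rk'kid _ vj; rewrite rkv; case fv: (f v); first by rewrite addn1 ltnn.
  rewrite vw in vj; move=> _.
  have := rk'kid _ vj; rewrite rkw; case fw: (f w); first by rewrite addn1 ltnn.
  move=> _; have [Gww wE] := par'P _ jw.
  by apply: (fmax _ _ (par' w)); rewrite ?inE ?Gwv ?Gww ?vw ?vj // -vj -wE eqxx.
move=> i ji; have [ij|nij] := eqVneq i j; last first.
  rewrite (eq_bigr (fun v => 2 ^ rk v)).
    by apply: Hsum; rewrite ltn_neqAle eq_sym nij.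
  by move=> v /eqP vi; rewrite rk'E // vi ltn_neqAle eq_sym nij.
subst i; have -> : [set v | j <= lev v] = [set v | lev v == j] :|: [set v | j < lev v].
  by apply/setP => v; rewrite !inE leq_eqVlt eq_sym.
rewrite cardsU disjoint_setI0 ?cards0 ?subn0; last first.
  by apply/pred0P => v; rewrite /= !inE; lia.
(* The summand 1 pays for a vertex without children, whose new rank is 0; the inner sums add up to
   the sum over level [j + 1]. *)
apply: (@leq_trans (\sum_(y | lev y == j) (1 + \sum_(x | kid y x) 2 ^ rk x))); last first.
  rewrite big_split /= -sum1dep_card leq_add2l.
  apply: leq_trans (Hsum j.+1 (leqnn _)).
  rewrite [X in _ <= X](partition_big par' (fun y => lev y == j)) //= => x /eqP xj.
  by have [|_] := par'P x; rewrite xj // => -[<-].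
apply: leq_sum => y /eqP yj; rewrite /rk' yj eqxx.
have [k0|k0] := eqVneq #|kid y| 0.
  by rewrite big_pred0 // => x; have := card0_eq k0 x.
have [x kx ->] := eq_bigmax_cond (fun x => rk x + f x)
  (ltac:(by rewrite lt0n) : 0 < #|kid y|).
rewrite unfold_in in kx; rewrite (bigD1 x) //=; case fx: (f x) => [z|] /=.
  have [x' x'x [fx' rkx']] := fpair _ _ fx.
  have [xj' xE] := andP kx.
  have zy : z = y by move: xE; rewrite /par' xj' fx /= => /eqP.
  have kx' : kid y x'.
    have [x'X _] := fX _ _ fx'; rewrite inE in x'X.
    by rewrite /kid x'X /par' x'X fx' /= zy eqxx.
  by rewrite (bigD1 x') /= ?kx' // rkx' expnD expn1; lia.
by rewrite addn0; lia.
Qed.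

(** Downward induction on the level; nothing lies below level [n], so any parents and ranks serve at
    the start. *)
Lemma ranked_tree : exists par rk, ranked_below 0 par rk.
Proof.
suff H i : i <= n.+1 -> exists par rk, ranked_below (n.+1 - i) par rk.
  by have := H n.+1 (leqnn _); rewrite subnn.
elim: i => [_|i IHi lei].
  have lev_le v : lev v <= n.
    by rewrite -[X in _ <= X]card_ord -[X in _ <= X](size_iota 0) find_size.
  exists id, (fun=> 0); rewrite subn0; split; try by move=> v *; have := lev_le v; lia.
  move=> i lei; rewrite big_pred0 // => v.
  by have := lev_le v; apply: contraTF => /eqP; lia.
have [par [rk]] := IHi (ltnW lei).
have -> : n.+1 - i = (n.+1 - i.+1).+1 by lia.
exact: ranked_below_step.
Qed.

End GatheringTree.

(** * Averages over finite choices *)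

Section Averages.
Variable R : realFieldType.
Local Open Scope ring_scope.

Definition avg (T : finType) (f : T -> R) : R := (\sum_x f x) / #|T|%:R.

Lemma avg_le (T : finType) (f g : T -> R) :
  (forall x, f x <= g x) -> avg f <= avg g.
Proof. by move=> fg; rewrite ler_wpM2r ?invr_ge0 ?ler0n //; apply: ler_sum. Qed.

Lemma eq_avg (T : finType) (f g : T -> R) : f =1 g -> avg f = avg g.
Proof. by move=> fg; rewrite /avg (eq_bigr g). Qed.

Lemma avgD (T : finType) (f g : T -> R) :
  avg (fun x => f x + g x) = avg f + avg g.
Proof. by rewrite /avg big_split mulrDl. Qed.

Lemma avgZ (T : finType) (a : R) (f : T -> R) :
  avg (fun x => a * f x) = a * avg f.
Proof. by rewrite /avg -mulr_sumr mulrA. Qed.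

Lemma avg_sum (T I : finType) (P : pred I) (f : I -> T -> R) :
  avg (fun x => \sum_(i | P i) f i x) = \sum_(i | P i) avg (f i).
Proof. by rewrite /avg exchange_big -mulr_suml. Qed.

Lemma avg_cst (T : finType) (a : R) : (0 < #|T|)%N -> avg (fun _ : T => a) = a.
Proof.
by move=> T0; rewrite /avg sumr_const -[X in X / _]mulr_natr mulfK // pnatr_eq0 -lt0n.
Qed.

Lemma avg_pair (T U : finType) (f : T * U -> R) :
  avg f = avg (fun x => avg (fun y => f (x, y))).
Proof.
rewrite /avg -mulr_suml (pair_bigA _ (fun x y => f (x, y))) /=.
rewrite card_prod natrM invfM mulrA mulrAC; congr (_ / _ / _).
by apply: eq_bigr => -[].
Qed.

Lemma avg_ge0 (T : finType) (f : T -> R) : (forall x, 0 <= f x) -> 0 <= avg f.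
Proof. by move=> f0; rewrite /avg divr_ge0 ?ler0n ?sumr_ge0. Qed.

(** Flipping the coin at [x] is an involution that exchanges agreement and disagreement. *)
Lemma avg_fair_coins (T : finType) (x y : T) : x != y ->
  avg (fun r : {ffun T -> bool} => (r x == r y)%:R) = 2^-1.
Proof.
move=> xy; pose flip (r : {ffun T -> bool}) := [ffun z => r z (+) (z == x)].
have flipK : involutive flip.
  by move=> r; apply/ffunP => z; rewrite !ffunE addbK.
set f := (fun r => _); suff H : avg f + avg f = 1 by lra.
rewrite {2}/avg (reindex_inj (inv_inj flipK)) -/(avg (f \o flip)) -avgD.
rewrite (@eq_avg _ _ (fun=> 1)) ?avg_cst //.
  by apply/card_gt0P; exists [ffun=> false].
move=> r; rewrite /f /= !ffunE eqxx [y == x]eq_sym (negPf xy) addbF.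
by case: (r x); case: (r y); rewrite /= ?addr0 ?add0r.
Qed.

Lemma avg_thresholds (I : finType) (Q a : nat) (A : {set I}) :
  (0 < Q)%N -> (a <= Q)%N ->
  avg (fun z : {ffun I -> 'I_Q} => \prod_(u in A) (z u < a)%:R) =
  (a%:R / Q%:R) ^+ #|A|.
Proof.
move=> Q0 aQ; rewrite /avg.
have -> : \sum_(z : {ffun I -> 'I_Q}) \prod_(u in A) ((z u < a)%:R : R) =
          \sum_(z : {ffun I -> 'I_Q})
            \prod_u (if u \in A then (z u < a)%:R else 1).
  by apply: eq_bigr => z _; rewrite big_mkcond.
rewrite -(bigA_distr_bigA (fun u (j : 'I_Q) => if u \in A then (j < a)%:R else 1)) /=.
have cnt : \sum_(j < Q) ((j < a)%:R : R) = a%:R.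
  rewrite -natr_sum; congr _%:R.
  rewrite -[RHS]card_ord -sum1_card (big_ord_widen Q (fun=> 1%N)) // [RHS]big_mkcond.
  by apply: eq_bigr => j _; case: ltnP.
have -> : \prod_u \sum_(j < Q) (if u \in A then (j < a)%:R else 1) =
          \prod_u (Q%:R * (if u \in A then a%:R / Q%:R else 1)) :> R.
  apply: eq_bigr => u _; case: ifP => _.
    by rewrite cnt mulrC divfK // pnatr_eq0 -lt0n.
  by rewrite sumr_const card_ord mulr1.
rewrite big_split /= prodr_const -big_mkcond /= prodr_const.
rewrite card_ffun card_ord natrX mulrC mulKf // expf_neq0 //.
by rewrite pnatr_eq0 -lt0n.
Qed.

(** With [p = a / Q] and [x = #|N|], the mean [x * p] lies in [1/4, 1/2], and the second moment
    bound is at least [x * p * (1 - x * p) >= 1/8]. *)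
Lemma avg_exactly_one (I : finType) (Q a : nat) (N : {set I}) :
  (0 < Q)%N -> (a <= Q)%N -> (Q <= 4 * (#|N| * a))%N -> (2 * (#|N| * a) <= Q)%N ->
  8^-1 <= avg (fun z : {ffun I -> 'I_Q} => (#|[set u in N | z u < a]%N| == 1%N)%:R).
Proof.
move=> Q0 aQ Qle Qge; set p : R := a%:R / Q%:R.
have Q0' : 0 < Q%:R :> R by rewrite ltr0n.
pose c u (z : {ffun I -> 'I_Q}) : R := (z u < a)%:R.
have c1 u : avg (c u) = p.
  rewrite -[RHS]expr1 -(cards1 u) -avg_thresholds //.
  by apply: eq_avg => z; rewrite big_set1.
have c2 u u' : u != u' -> avg (fun z => c u z * c u' z) = p ^+ 2.
  move=> uu'; have <- : #|[set u; u']| = 2%N by rewrite cards2 uu'.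
  rewrite -avg_thresholds //.
  by apply: eq_avg => z; rewrite big_setU1 ?inE //= big_set1.
(* second moment: 1[S = 1] >= S - S (S - 1) for the number S of selected points *)
apply: le_trans (_ : avg (fun z => \sum_(u in N)
    (c u z - \sum_(u' in N | u' != u) c u z * c u' z)) <= _); last first.
  apply: avg_le => z; set S := [set u in N | _].
  have sumS (f : I -> R) : \sum_(u in N) c u z * f u = \sum_(u in S) f u.
    rewrite (bigID (fun u => z u < a)%N) /= [X in _ + X]big1 ?addr0.
      apply: eq_big => [u|u /andP[_ lt]]; first by rewrite inE.
      by rewrite /c lt mul1r.
    by move=> u /andP[_ /negPf lt]; rewrite /c lt mul0r.
  under eq_bigr => u uN.
    rewrite -[X in X - _]mulr1 -mulr_sumr -mulrBr.
    have -> : \sum_(u' in N | u' != u) c u' z = \sum_(u' in S) (u' != u)%:R.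
      rewrite -sumS [RHS](bigID (fun u' => u' != u)) /= [X in _ + X]big1 ?addr0.
        by apply: eq_bigr => u' /andP[_ ->]; rewrite mulr1.
      by move=> u' /andP[_ /negPf->]; rewrite mulr0.
  over.
  rewrite sumS; case: eqVneq => [/eqP/cards1P[u ->]|S1].
    by rewrite !big_set1 eqxx subr0.
  apply: sumr_le0 => u uS; rewrite subr_le0.
  have [u' /andP[u'S u'u]] : exists u', (u' \in S) && (u' != u).
    apply/existsP; apply: contraR S1; rewrite negb_exists => /forallP Su.
    apply/cards1P; exists u; apply/setP => u'; rewrite inE.
    apply/idP/eqP => [u'S|-> //]; apply/eqP.
    by have := Su u'; rewrite u'S negbK.
  by rewrite (bigD1 u') //= u'u lerDl sumr_ge0.
rewrite avg_sum.
rewrite (eq_bigr (fun u => p - (#|N|%:R - 1) * p ^+ 2)); last first.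
  move=> u uN; under eq_avg do rewrite -mulN1r.
  rewrite avgD avgZ c1 mulN1r avg_sum (eq_bigr (fun=> p ^+ 2)).
    congr (_ - _); rewrite sumr_const -[LHS]mulr_natl; congr (_ * _).
    have := cardsD1 u N; rewrite uN add1n => ->.
    rewrite -natr1 addrK; congr _%:R; apply: eq_card => v.
    by rewrite !inE andbC.
  by move=> u' /andP[_ u'u]; rewrite c2 // eq_sym.
rewrite sumr_const -[X in _ <= X]mulr_natl.
set x : R := #|N|%:R.
have xp4 : 4^-1 <= x * p.
  rewrite /x /p mulrA ler_pdivlMr //.
  by move: Qle; rewrite -(ler_nat R) !natrM; lra.
have xp2 : x * p <= 2^-1.
  rewrite /x /p mulrA ler_pdivrMr //.
  by move: Qge; rewrite -(ler_nat R) !natrM; lra.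
have p0 : 0 <= p by rewrite /p divr_ge0 ?ler0n.
have x0 : 0 <= x by rewrite /x ler0n.
by nra.
Qed.

Section Sequences.
Variable T : finType.
Hypothesis T0 : (0 < #|T|)%N.

(** Expectation over [t] independent uniform draws. The head is the latest draw, so the inner
    average is conditional on the past. *)
Fixpoint expect t (f : seq T -> R) : R :=
  if t is t'.+1 then expect t' (fun w => avg (fun x => f (x :: w))) else f [::].

Lemma expect_le t f g : (forall w, size w = t -> f w <= g w) ->
  expect t f <= expect t g.
Proof.
elim: t f g => [|t IHt] f g fg /=; first exact: fg.
by apply: IHt => w wt; apply: avg_le => x; rewrite fg //= wt.
Qed.

Lemma eq_expect t f g : (forall w, size w = t -> f w = g w) ->
  expect t f = expect t g.
Proof.
by move=> fg; apply/eqP; rewrite eq_le !expect_le // => w wt; rewrite fg.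
Qed.

Lemma expectD t f g : expect t (fun w => f w + g w) = expect t f + expect t g.
Proof.
elim: t f g => [//|t IHt] f g /=; rewrite -IHt.
by apply: eq_expect => w _; rewrite avgD.
Qed.

Lemma expectZ t a f : expect t (fun w => a * f w) = a * expect t f.
Proof.
elim: t f => [//|t IHt] f /=; rewrite -IHt.
by apply: eq_expect => w _; rewrite avgZ.
Qed.

Lemma expect_cst t a : expect t (fun=> a) = a.
Proof.
elim: t => [//|t IHt] /=; rewrite -[RHS]IHt.
by apply: eq_expect => w _; rewrite avg_cst.
Qed.

Lemma expect_sum (I : finType) (P : pred I) t (f : I -> seq T -> R) :
  expect t (fun w => \sum_(i | P i) f i w) = \sum_(i | P i) expect t (f i).
Proof.
elim: t f => [//|t IHt] f /=; rewrite -IHt.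
by apply: eq_expect => w _; rewrite avg_sum.
Qed.

Lemma expect_avg (U : finType) t (f : U -> seq T -> R) :
  expect t (fun w => avg (f^~ w)) = avg (fun z => expect t (f z)).
Proof.
rewrite /avg -expect_sum mulrC -expectZ.
by apply: eq_expect => w _; rewrite mulrC.
Qed.

Lemma expect_drop d t f : expect (d + t) (fun w => f (drop d w)) = expect t f.
Proof.
elim: d => [|d IHd] /=.
  by apply: eq_expect => w _; rewrite drop0.
by rewrite -IHd; apply: eq_expect => w _; rewrite avg_cst.
Qed.

(** This is where the probabilistic method turns an expectation into a fixed schedule. *)
Lemma expect_lt1 t f : expect t f < 1 -> exists2 w, size w = t & f w < 1.
Proof.
move=> lt1; apply: contrapT => /forall2NP nex.
have : expect t (fun=> 1) <= expect t f.
  by apply: expect_le => w wt; case: (nex w) => [//|/negP]; rewrite -leNgt.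
by rewrite expect_cst leNgt lt1.
Qed.

End Sequences.
End Averages.

(** * Estimates for powers of 1 - e *)

Lemma bernoulli_sub (R : realFieldType) (e : R) m : (0 <= e <= 1)%R ->
  (1 - m%:R * e <= (1 - e) ^+ m)%R.
Proof.
case/andP => e0 e1; elim: m => [|m IHm]; first by rewrite mul0r subr0 expr0.
have e1' : (0 <= 1 - e)%R by rewrite subr_ge0.
rewrite exprS; apply: le_trans (ler_wpM2l e1' IHm).
have : (0 <= m%:R :> R)%R by rewrite ler0n.
by rewrite -natr1; nra.
Qed.

(** With [e = 1 / N], Bernoulli gives [(1 + e) ^ N >= 2], while [(1 - e) ^ N * (1 + e) ^ N <= 1]. *)
Lemma exp_one_minus_inv (R : realFieldType) N : 0 < N ->
  ((1 - N%:R^-1) ^+ N <= 2^-1 :> R)%R.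
Proof.
move=> N0; set e : R := (N%:R^-1)%R.
have N0' : (0 < N%:R :> R)%R by rewrite ltr0n.
have e0 : (0 <= e)%R by rewrite invr_ge0 ltW.
have e1 : (e <= 1)%R by rewrite invf_le1 // ler1n.
have two : (2 <= (1 + e) ^+ N)%R.
  have bern k : (1 + k%:R * e <= (1 + e) ^+ k)%R.
    elim: k => [|k IHk]; first by rewrite mul0r addr0 expr0.
    have e1' : (0 <= 1 + e)%R by rewrite addr_ge0.
    rewrite exprS; apply: le_trans (ler_wpM2l e1' IHk).
    have : (0 <= k%:R :> R)%R by rewrite ler0n.
    by rewrite -natr1; nra.
  by apply: le_trans (bern N); rewrite mulfV ?gt_eqF.
have prod1 : ((1 - e) ^+ N * (1 + e) ^+ N <= 1)%R.
  by rewrite -exprMn exprn_ile1 //; nra.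
have : (0 <= (1 - e) ^+ N)%R by rewrite exprn_ge0 // subr_ge0.
by move: ((1 - e) ^+ N)%R ((1 + e) ^+ N)%R two prod1 => a b *; nra.
Qed.

(** * Waves and random slow rounds *)

(** This is [receive] with an arbitrary payload, so that single bits and whole packets obey one
    collision rule. *)
Definition hear n (G : graph n) (T : Type) (x : 'I_n -> option T) (v : 'I_n) :
    option T :=
  if x v is Some _ then None
  else if [seq u <- enum 'I_n | G v u && isSome (x u)] is [:: u] then x u
  else None.

Lemma hear_map n (G : graph n) (T U : Type) (f : T -> U) (x : 'I_n -> option T) v :
  omap f (hear G x v) = hear G (fun u => omap f (x u)) v.
Proof.
have eqx u : isSome (omap f (x u)) = isSome (x u) by case: (x u).
rewrite /hear; under eq_filter do rewrite -eqx.
by case: (x v) => //=; case: filter => [|u []].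
Qed.

Lemma eq_hear n (G : graph n) (T : Type) (x y : 'I_n -> option T) v :
  x =1 y -> hear G x v = hear G y v.
Proof. by move=> xy; congr hear; apply/funext. Qed.

Lemma hear_unique n (G : graph n) (T : Type) (x : 'I_n -> option T) v u :
  x v = None -> G v u -> x u -> (forall u', G v u' -> x u' -> u' = u) ->
  hear G x v = x u.
Proof.
move=> xv Gvu xu uni; rewrite /hear xv.
suff -> : [seq u <- enum 'I_n | G v u && isSome (x u)] = [:: u] by [].
apply: perm_small_eq => //; apply: uniq_perm => // [|u'].
  by rewrite filter_uniq ?enum_uniq.
rewrite mem_filter mem_enum andbT inE.
by apply/andP/eqP => [[]|->//]; exact: uni.
Qed.

Section Schedule.
Variables (n : nat) (G : graph n) (s : 'I_n).
Hypothesis conn : connected G.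
Variables (par : 'I_n -> 'I_n) (rk : 'I_n -> nat).
Hypothesis tree : ranked_below G s 0 par rk.

Let lev := hops G s.
Let h := (trunc_log 2 n).+1.

Lemma lev_gt0 v : (0 < lev v) = (v != s).
Proof. by rewrite lt0n hops_eq0. Qed.

Lemma lev_edge u v : G u v -> lev v <= (lev u).+1.
Proof. exact: hops_edge. Qed.

Lemma par_adj v : v != s -> G (par v) v.
Proof. by rewrite -lev_gt0; case: tree => P _ _ _ /P[]. Qed.

Lemma par_lev v : v != s -> lev v = (lev (par v)).+1.
Proof. by rewrite -lev_gt0; case: tree => P _ _ _ /P[]. Qed.

(** The term of [v] in the sum over its level gives [2 ^ rk v <= n]. *)
Lemma rk_lt v : rk v < h.
Proof.
case: tree => _ _ _ /(_ (lev v) (leq0n _)) sum_le.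
apply: trunc_log_max => //; apply: leq_trans (_ : #|'I_n| <= n); last by rewrite card_ord.
apply: leq_trans (max_card _); apply: leq_trans sum_le.
by rewrite (bigD1 v) //= leq_addr.
Qed.

(** * Fast stretches and the virtual graph *)

Definition fast v := (v != s) && (rk (par v) == rk v).

Fixpoint head_rec f v :=
  if f is f'.+1 then if fast v then head_rec f' (par v) else v else v.

Definition head v := head_rec (lev v) v.

Lemma head_slow v : ~~ fast v -> head v = v.
Proof. by rewrite /head; case: (lev v) => //= l /negPf->. Qed.

Lemma head_fast v : fast v -> head v = head (par v).
Proof. by move=> fv; have [/par_lev vE _] := andP fv; rewrite /head vE /= fv. Qed.

Lemma fast_ind (P : 'I_n -> Prop) :
  (forall v, ~~ fast v -> P v) -> (forall v, fast v -> P (par v) -> P v) ->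
  forall v, P v.
Proof.
move=> Pslow Pfast v; have [l le] := ubnP (lev v); elim: l v le => // l IHl v le.
have [fv|/Pslow//] := boolP (fast v); apply: Pfast => //; apply: IHl.
by have [/par_lev] := andP fv; lia.
Qed.

Lemma fast_head v : ~~ fast (head v).
Proof.
by elim/fast_ind: v => [v fv|v fv IH]; rewrite ?(head_slow fv) ?(head_fast fv).
Qed.

Lemma rk_head v : rk (head v) = rk v.
Proof.
elim/fast_ind: v => [v fv|v fv IH]; first by rewrite (head_slow fv).
by rewrite (head_fast fv) IH; case/andP: fv => _ /eqP.
Qed.

Lemma lev_head v : lev (head v) <= lev v.
Proof.
elim/fast_ind: v => [v fv|v fv IH]; first by rewrite (head_slow fv).
by rewrite (head_fast fv); case/andP: fv => /par_lev ->; lia.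
Qed.

Definition has_fast_child u := [exists v, fast v && (par v == u)].

Lemma head_fast_child v : fast v -> has_fast_child (head v).
Proof.
elim/fast_ind: v => [v /negPf->//|v fv IH _]; rewrite (head_fast fv).
have [/IH//|/head_slow ->] := boolP (fast (par v)).
by apply/existsP; exists v; rewrite fv eqxx.
Qed.

(* The virtual graph adds to G a shortcut from the head of each stretch of
   fast edges to all of its vertices; its radius is logarithmic. *)
Definition vedge : rel 'I_n := fun u v => G u v || fast v && (u == head v).

Definition vdist := hops vedge s.

Lemma vconn v : connect vedge s v.
Proof.
apply: (@connect_sub _ G); last exact: conn.
by move=> u w Guw; apply: connect1; rewrite /vedge Guw.
Qed.

Lemma vdist_edge u v : G u v -> vdist v <= (vdist u).+1.
Proof. by move=> Guv; apply: (hops_edge vconn); rewrite /vedge Guv. Qed.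

Lemma vdist_head v : vdist v <= (vdist (head v)).+1.
Proof.
have [fv|/head_slow->//] := boolP (fast v).
by apply: (hops_edge vconn); rewrite /vedge fv eqxx orbT.
Qed.

(** Induction towards the root. A slow tree edge raises the rank, and the gain of 2 pays for that
    edge and for a possibly fast parent. A fast vertex is one shortcut away from its head, which has
    the same rank and is not fast. *)
Lemma vdist_le v : vdist v + 2 * rk v <= 2 * h.-1 + fast v.
Proof.
have [l le] := ubnP (lev v); elim: l v le => // l IHl v le.
have [->|vs] := eqVneq v s.
  by rewrite /vdist hops_root; have := rk_lt s; lia.
have vE := par_lev vs; have [fv|nfv] := boolP (fast v).
  have := lev_head v; rewrite leq_eqVlt => /orP[/eqP E|lt].
    have := lev_head (par v); rewrite -(head_fast fv) E; lia.
  have := IHl (head v); rewrite (negPf (fast_head v)) rk_head => /(_ _).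
  by have := vdist_head v; lia.
have := IHl (par v); have := vdist_edge (par_adj vs).
have [_ rkle _ _] := tree; have := rkle v; rewrite lev_gt0 vs => /(_ isT).
by rewrite leq_eqVlt; move: nfv; rewrite /fast vs /= eq_sym; case: eqP => //= _ _; lia.
Qed.

Lemma vdist_lt v : vdist v < 2 * h.
Proof. by have := vdist_le v; rewrite /h /=; case: fast; lia. Qed.

(** * Random choices and what the nodes hear *)

Variable M : finType.

(** A residue modulo 3, an exponent [i], and a number for each node; comparing that number with
    [2 ^ (h.-1 - i)] is a coin of bias 2^-(i+2). *)
Definition sampling : finType := ('I_3 * 'I_h * {ffun 'I_n -> 'I_(2 ^ h.+1)})%type.
Definition coding : finType := {ffun 'I_n * M -> bool}.
Definition choices : finType := (sampling * coding)%type.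

(** Nodes active together have levels equal modulo 3, and on one level they have equal ranks because
    [rk u < h]. Along a stretch of constant rank the active level advances by one every two
    rounds. *)
Definition wavefront t u := t./2 == lev u + 3 * rk u %[mod 3 * h].

Definition emits (a : sampling) t u :=
  if odd t then (vdist u == a.1.1 %[mod 3]) && (a.2 u < 2 ^ (h.-1 - a.1.2))
  else has_fast_child u && wavefront t u.

(* L m is what the node would have heard by now had m been broadcast. *)
Definition representative (L : M -> seq (option bool)) (inp : option M)
    (hist : seq (option bool)) : option M :=
  if inp is Some m then Some m else [pick m | L m == hist].

(* Even rounds carry the waves: in round t a non-head vertex of a stretch
   forwards what it heard from its parent in round t - 2. *)
Definition emit (x : choices) t (L : M -> seq (option bool)) u inp hist :
    option bool :=
  if ~~ emits x.1 t u then None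
  else Some (if ~~ odd t && fast u then odflt false (nth None hist (t - 2))
             else if representative L inp hist is Some m then x.2 (u, m)
             else false).

Definition source_input (m : M) u : option M := if u == s then Some m else None.

(* The choices of the successive rounds are listed most recent first. *)
Fixpoint heard (w : seq choices) (m : M) (v : 'I_n) : seq (option bool) :=
  if w is x :: w' then
    rcons (heard w' m v)
      (hear G (fun u => emit x (size w') (heard w' ^~ u) u (source_input m u)
                          (heard w' m u)) v)
  else [::].

Definition sent x w m u :=
  emit x (size w) (heard w ^~ u) u (source_input m u) (heard w m u).

Lemma heard_cons x w m v :
  heard (x :: w) m v = rcons (heard w m v) (hear G (sent x w m) v).
Proof. by []. Qed.

Lemma size_heard w m v : size (heard w m v) = size w.
Proof. by elim: w => //= x w IHw; rewrite size_rcons IHw. Qed.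

Lemma nth_heard w1 w2 m v j : j < size w2 ->
  nth None (heard (w1 ++ w2) m v) j = nth None (heard w2 m v) j.
Proof.
move=> jlt; elim: w1 => // x w1 IHw; rewrite cat_cons heard_cons nth_rcons.
by rewrite size_heard size_cat (leq_trans jlt (leq_addl _ _)).
Qed.

Lemma nth_heard_last w1 x w m v :
  nth None (heard (w1 ++ x :: w) m v) (size w) = hear G (sent x w m) v.
Proof.
by rewrite nth_heard ?ltnSn // heard_cons nth_rcons size_heard ltnn eqxx.
Qed.

Lemma isSome_sent x w m u : sent x w m u = emits x.1 (size w) u :> bool.
Proof. by rewrite /sent /emit; case: emits. Qed.

(** An active neighbor of [v] has the level of [par v] modulo 3, hence exactly, and then the same
    rank. It has a fast child, so the collision condition of the ranked tree identifies it with
    [par v]. *)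
Lemma hear_wave x w m v : fast v -> ~~ odd (size w) ->
  wavefront (size w) (par v) -> hear G (sent x w m) v = sent x w m (par v).
Proof.
move=> fv evt wv; have [vs /eqP rkv] := andP fv.
have vE := par_lev vs; have Gpv := par_adj vs.
have emE u : emits x.1 (size w) u = has_fast_child u && wavefront (size w) u.
  by rewrite /emits (negPf evt).
have mod3 u : wavefront (size w) u -> lev u = lev (par v) %[mod 3].
  move=> /eqP wu; have /eqP wv' := wv; rewrite wv' in wu.
  have := congr1 (modn^~ 3) wu; rewrite !modn_dvdm ?dvdn_mulr //.
  by rewrite ![_ + 3 * _]addnC ![3 * rk _]mulnC !modnMDl.
apply: hear_unique.
- suff : ~~ isSome (sent x w m v) by case: sent.
  rewrite isSome_sent emE; apply/negP => /andP[_ /mod3]; rewrite vE; lia.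
- by rewrite adj_sym.
- rewrite isSome_sent emE wv andbT; apply/existsP; exists v.
  by rewrite fv eqxx.
move=> u Gvu; rewrite isSome_sent emE => /andP[/existsP[v' /andP[fv' /eqP uE]] wu].
have lu := mod3 _ wu; have le1 := lev_edge Gvu.
have Guv : G u v by rewrite adj_sym.
have le2 := lev_edge Guv; have {lu} lu : lev u = lev (par v) by lia.
have rku : rk u = rk (par v).
  move: wu wv; rewrite /wavefront lu => /eqP-> /eqP /eqP.
  have ru := rk_lt u; have rp := rk_lt (par v).
  by rewrite eqn_modDl !modn_small; lia.
have [v's /eqP rkv'] := andP fv'.
have [_ _ col _] := tree; rewrite -uE (col v v') //; rewrite ?lev_gt0 // ?uE //.
  by rewrite [RHS](par_lev v's) uE lu -vE.
by rewrite -rkv -rkv' uE.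
Qed.

Definition launch v t := ~~ odd t && wavefront t (head v).

Lemma wave_arrives w1 x w m v : fast v -> launch v (size w) ->
  2 * (lev v - lev (head v)) - 2 <= size w1 ->
  nth None (heard (w1 ++ x :: w) m v)
    (size w + (2 * (lev v - lev (head v)) - 2)) = sent x w m (head v).
Proof.
move=> fv lau; elim/fast_ind: v w1 fv lau => [v /negPf->//|v fv IH w1 _ lau le].
have [vs /eqP rkv] := andP fv; have vE := par_lev vs.
have [evt wfr] := andP lau; have hE := head_fast fv.
have [fp|/head_slow pE] := boolP (fast (par v)); last first.
  have -> : lev v - lev (head v) = 1 by rewrite hE pE vE; lia.
  rewrite addn0 nth_heard_last; move: wfr; rewrite hE pE => wfr.
  by rewrite hear_wave.
have lev_lt : lev (head (par v)) < lev (par v).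
  have [ps _] := andP fp.
  by rewrite (head_fast fp) (par_lev ps) ltnS lev_head.
set i := lev v - lev (head v) in le *.
have iE : i = (lev (par v) - lev (head (par v))).+1 by rewrite /i hE vE; lia.
set i' := lev (par v) - lev (head (par v)) in iE; have i'0 : 0 < i' by lia.
(* Cutting here makes [y] the choice of round [size w + (2 * i - 2)], in which [par v] relays, and
   [w4] the rounds between launch and relay. *)
set k := size w1 - (2 * i - 2).
have : size (drop k w1) = 2 * i - 2 by rewrite size_drop; lia.
have w1E := cat_take_drop k w1; case E: (drop k w1) => [|y w4] /=; first by lia.
move=> w4s; rewrite -w1E E -catA cat_cons.
have tE : size (w4 ++ x :: w) = size w + (2 * i - 2) by rewrite size_cat /=; lia.
have evt' : ~~ odd (size (w4 ++ x :: w)).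
  by rewrite tE oddD (negPf evt) iE mulnS addKn mul2n odd_double.
have wfr' : wavefront (size (w4 ++ x :: w)) (par v).
  move: wfr; rewrite /wavefront tE => /eqP wfr.
  have -> : (size w + (2 * i - 2))./2 = (size w)./2 + i'.
    by rewrite iE mulnS addKn halfD mul2n odd_double andbF doubleK.
  rewrite -modnDml wfr modnDml hE rk_head.
  have -> : lev (par v) = lev (head (par v)) + i' by rewrite /i'; lia.
  by rewrite addnAC.
rewrite -tE nth_heard_last hear_wave // /sent /emit.
have -> /= : emits y.1 (size (w4 ++ x :: w)) (par v).
  rewrite /emits (negPf evt') wfr' andbT; apply/existsP; exists v.
  by rewrite fv eqxx.
rewrite evt' fp /=.
have -> : size (w4 ++ x :: w) - 2 = size w + (2 * i' - 2) by rewrite tE; lia.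
have lau' : launch (par v) (size w) by rewrite /launch evt -hE.
rewrite IH //; last by rewrite -ltnS w4s -/i'; lia.
rewrite -hE; have : isSome (sent x w m (head v)).
  by rewrite isSome_sent /emits (negPf evt) wfr head_fast_child.
by rewrite /sent /emit; case: emits.
Qed.

Section Pair.
Variables (m m' : M).
Hypothesis mm' : m != m'.

Definition knows w v := (v == s) || (heard w m v != heard w m' v).

Fixpoint served w v :=
  if w is x :: w' then
    served w' v ||
      launch v (size w') && (sent x w' m (head v) != sent x w' m' (head v))
  else false.

Lemma knows_cons x w v : knows w v -> knows (x :: w) v.
Proof.
rewrite /knows => /orP[->//|ne]; rewrite !heard_cons.
by rewrite eqseq_rcons negb_and ne orbT.
Qed.

Lemma knows_hear x w v :
  hear G (sent x w m) v != hear G (sent x w m') v -> knows (x :: w) v.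
Proof.
by move=> ne; rewrite /knows !heard_cons eqseq_rcons negb_and ne !orbT.
Qed.

Lemma served_knows w1 w v : fast v -> served w v ->
  2 * (lev v - lev (head v)) <= size w1 -> knows (w1 ++ w) v.
Proof.
move=> fv; elim: w w1 => //= x w IHw w1 /orP[sw le|/andP[lau ne] le].
  rewrite -cat_rcons; apply: IHw => //; rewrite size_rcons.
  exact: leq_trans le _.
apply/orP; right; apply: contraNneq ne => eq_heard.
have le' : 2 * (lev v - lev (head v)) - 2 <= size w1.
  exact: leq_trans (leq_subr _ _) le.
by rewrite -!(wave_arrives _ _ fv lau le') eq_heard.
Qed.

(** A common representative would match both histories and make them equal. The coding is therefore
    read at two distinct entries. *)
Lemma representative_knows w u : knows w u ->
  exists m1 m2, [/\ m1 != m2,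
    representative (heard w ^~ u) (source_input m u) (heard w m u) = Some m1
  & representative (heard w ^~ u) (source_input m' u) (heard w m' u) = Some m2].
Proof.
rewrite /knows /source_input; case: eqP => _ /= ne; first by exists m, m'.
case: pickP => [m1 /eqP E1|/(_ m)]; last by rewrite eqxx.
case: pickP => [m2 /eqP E2|/(_ m')]; last by rewrite eqxx.
exists m1, m2; split=> //; apply: contraNneq ne => m12.
by rewrite -E1 -E2 m12.
Qed.

Variable R : realFieldType.
Local Open Scope ring_scope.

Lemma avg_coding (a : sampling) w u : emits a (size w) u ->
  odd (size w) || ~~ fast u ->
  avg (fun r : coding => (sent (a, r) w m u == sent (a, r) w m' u)%:R) <=
    2^-1 + 2^-1 * (~~ knows w u)%:R :> R.
Proof.
move=> em nf; have [ku|_] := boolP (knows w u); last first.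
  rewrite /= mulr1 [X in _ <= X](_ : _ = 1); last by lra.
  rewrite -[X in _ <= X](@avg_cst _ coding); last first.
    by apply/card_gt0P; exists [ffun=> false].
  by apply: avg_le => r; rewrite lern1; case: eqP.
have [m1 [m2 [m12 E1 E2]]] := representative_knows ku.
rewrite mulr0 addr0 -(@avg_fair_coins R _ (u, m1) (u, m2)); last first.
  by apply: contra_neq m12 => -[].
apply: avg_le => r; rewrite /sent /emit em E1 E2 /=.
have -> : ~~ odd (size w) && fast u = false.
  by case/orP: nf => [->//|/negPf->]; rewrite andbF.
by [].
Qed.

(** * Probability of not separating two vectors *)

Definition unknown t v : R := expect t (fun w => (~~ knows w v)%:R).
Definition unserved t v : R := expect t (fun w => (~~ served w v)%:R).

Lemma choices_gt0 : (0 < #|choices|)%N.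
Proof.
apply/card_gt0P.
by exists (ord0, @ord0 (trunc_log 2 n), [ffun=> Ordinal (expn_gt0 2 h.+1)],
           [ffun=> false]).
Qed.

Lemma expect_bool_le1 t (b : seq choices -> bool) :
  expect t (fun w => (b w)%:R) <= 1 :> R.
Proof.
rewrite -[X in _ <= X](expect_cst choices_gt0 t); apply: expect_le => w _.
by rewrite lern1 leq_b1.
Qed.

Lemma expect_bool_mono (b : seq choices -> bool) t t' :
  (forall x w, b (x :: w) -> b w) -> (t <= t')%N ->
  expect t' (fun w => (b w)%:R) <= expect t (fun w => (b w)%:R) :> R.
Proof.
move=> bmono /subnK <-; elim: (t' - t)%N => //= d IHd.
apply: le_trans IHd; apply: expect_le => w _.
rewrite -[X in _ <= X](@avg_cst _ choices) ?choices_gt0 //.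
apply: avg_le => x; rewrite ler_nat.
by have := @bmono x w; case: (b _); case: (b w) => // ->.
Qed.

Lemma unknown_mono t t' v : (t <= t')%N -> unknown t' v <= unknown t v.
Proof. by apply: expect_bool_mono => x w; apply: contra; exact: knows_cons. Qed.

Lemma unserved_mono t t' v : (t <= t')%N -> unserved t' v <= unserved t v.
Proof. by apply: expect_bool_mono => x w /= /norP[]. Qed.

Lemma unknown_unserved t d v : fast v -> d = (2 * (lev v - lev (head v)))%N ->
  unknown (d + t) v <= unserved t v.
Proof.
move=> fv dE; rewrite /unserved -(expect_drop choices_gt0 d).
apply: expect_le => w wt; rewrite ler_nat.
have [sw|_] := boolP (served _ v); last exact: leq_b1.
rewrite -{1}(cat_take_drop d w) served_knows // size_takel ?dE //.
by rewrite wt -dE leq_addr.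
Qed.

Definition feeders v := [set u | G v u && ((vdist u).+1 == vdist v)].

Definition isolates (a : sampling) v :=
  ((vdist v).-1 == a.1.1 %[mod 3]) &&
  (#|[set u in feeders v | (a.2 u < 2 ^ (h.-1 - a.1.2))%N]| == 1%N).

(** Virtual distances of neighbors differ by at most one, so the residue modulo 3 silences [v] and
    all its neighbors except the feeders. *)
Lemma hear_isolated a w v : odd (size w) -> (0 < vdist v)%N -> isolates a v ->
  exists u, [/\ u \in feeders v, emits a (size w) u
    & forall r m0, hear G (sent (a, r) w m0) v = sent (a, r) w m0 u].
Proof.
move=> odw dv /andP[/eqP cE /cards1P[u SE]].
have emE u' : emits a (size w) u' =
    (vdist u' == a.1.1 %[mod 3]) && (a.2 u' < 2 ^ (h.-1 - a.1.2))%N.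
  by rewrite /emits odw.
have : u \in [set u] by rewrite inE.
rewrite -SE inE => /andP[uf uz]; have := uf; rewrite inE => /andP[Gvu /eqP ud].
have uem : emits a (size w) u by rewrite emE uz andbT -cE -ud.
exists u; split=> // r m0; apply: hear_unique => //.
- suff : ~~ isSome (sent (a, r) w m0 v) by case: sent.
  rewrite isSome_sent emE negb_and -cE; apply/orP; left; apply/eqP; lia.
- by rewrite isSome_sent.
move=> u' Gvu'; rewrite isSome_sent emE -cE => /andP[/eqP u'd u'z].
apply/set1P; rewrite -SE !inE u'z Gvu' !andbT /=; apply/eqP.
have Gu'v : G u' v by rewrite adj_sym.
by have := vdist_edge Gvu'; have := vdist_edge Gu'v; lia.
Qed.

Lemma avg_isolated a w v u :
  (forall r m0, hear G (sent (a, r) w m0) v = sent (a, r) w m0 u) ->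
  emits a (size w) u -> odd (size w) ->
  avg (fun r : coding => (~~ knows ((a, r) :: w) v)%:R) <=
    2^-1 * (~~ knows w v)%:R + 2^-1 * (~~ knows w u)%:R :> R.
Proof.
move=> hE em odw; have [kv|nkv] := boolP (knows w v).
  rewrite (@eq_avg _ _ _ (fun=> 0)); last by move=> r; rewrite knows_cons.
  rewrite avg_cst; last by apply/card_gt0P; exists [ffun=> false].
  by rewrite mulr0 add0r mulr_ge0 ?invr_ge0 ?ler0n.
rewrite mulr1; apply: le_trans (avg_coding em _); last by rewrite odw.
apply: avg_le => r; rewrite ler_nat; case: eqP => [_|ne]; first exact: leq_b1.
by rewrite knows_hear // !hE; apply/eqP.
Qed.

(** The factors are 1/3 for the right residue, [1/h] for the right exponent and 1/8 for a unique
    feeder. *)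
Lemma avg_isolates v : (0 < vdist v)%N -> feeders v != set0 ->
  (24 * h%:R)^-1 <= avg (fun a : sampling => (isolates a v)%:R) :> R.
Proof.
move=> dv; rewrite -card_gt0; set N := feeders v => N0.
have /andP[leN ltN] := trunc_log_bounds (ltac:(by []) : (1 < 2)%N) N0.
(* For this exponent the expected number of selected feeders is between 1/4 and 1/2. *)
set i := trunc_log 2 #|N| in leN ltN.
have lti : (i < h)%N.
  rewrite ltnS leq_trunc_log //.
  by apply: leq_trans (max_card _) _; rewrite card_ord.
have ltc : ((vdist v).-1 %% 3 < 3)%N by rewrite ltn_mod.
pose ci := (Ordinal ltc, Ordinal lti).
rewrite avg_pair.
apply: le_trans (_ : avg (fun x : 'I_3 * 'I_h => 8^-1 * (x == ci)%:R) <= _).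
  rewrite avgZ /avg (bigD1 ci) //= eqxx big1 ?addr0 => [|x /negPf->//].
  rewrite card_prod !card_ord natrM le_eqVlt; apply/orP; left; apply/eqP.
  by rewrite mul1r -invfM mulrA -!natrM.
apply: avg_le => x; have [->|_] := eqVneq x ci; last first.
  by rewrite mulr0; apply: avg_ge0 => z; rewrite ler0n.
rewrite mulr1 /isolates /= modn_mod eqxx /=.
have pE : (2 ^ h.+1 = 2 * (2 ^ i.+1 * 2 ^ (h.-1 - i)))%N.
  by rewrite -expnD -expnS; congr (_ ^ _)%N; have := lti; rewrite /h /=; lia.
apply: avg_exactly_one; rewrite ?expn_gt0 //.
- by rewrite leq_exp2l //; have := lti; rewrite /h /=; lia.
- by rewrite pE expnS -mulnA mulnA leq_mul // leq_mul.
by rewrite pE leq_mul // leq_mul // ltnW.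
Qed.

(** With probability at least [1 / (24 * h)] a single feeder is heard, and then the excess over [g]
    is halved. *)
Lemma slow_step t v g g' : odd t -> (0 < vdist v)%N -> feeders v != set0 ->
  (forall u, u \in feeders v -> unknown t u <= g) -> g <= g' ->
  unknown t v <= g' ->
  unknown t.+1 v <= g' - (48 * h%:R)^-1 * (g' - g).
Proof.
move=> odt dv fne ug gg' vg'.
have h0 : 0 < h%:R :> R by rewrite ltr0n.
have mono := unknown_mono v (leqnSn t).
set p := unknown t v in vg' mono *.
have theta : (48 * h%:R)^-1 = 2^-1 * (24 * h%:R)^-1 :> R by field; lra.
have th0 : 0 <= (24 * h%:R)^-1 :> R by rewrite invr_ge0 mulr_ge0 ?ler0n.
have th1 : (24 * h%:R)^-1 <= 1 :> R.
  rewrite invf_le1; last by rewrite mulr_gt0.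
  by rewrite -natrM ler1n muln_gt0.
rewrite theta; set th := (24 * h%:R)^-1 in th0 th1 *.
have [pg|gp] := leP p g; first by nra.
suff : unknown t.+1 v <= p - 2^-1 * th * (p - g) by nra.
rewrite /unknown /=; under eq_expect do rewrite avg_pair.
rewrite (expect_avg t (fun (a : sampling) w =>
  avg (fun r : coding => (~~ knows ((a, r) :: w) v)%:R))).
apply: le_trans (_ : avg (fun a => p + 2^-1 * (g - p) * (isolates a v)%:R) <= _).
  apply: avg_le => a; have [iso|_] := boolP (isolates a v); last first.
    rewrite mulr0 addr0; apply: expect_le => w wt.
    rewrite -[X in _ <= X](@avg_cst _ coding); last first.
      by apply/card_gt0P; exists [ffun=> false].
    apply: avg_le => r; rewrite ler_nat; have := @knows_cons (a, r) w v.
    by case: (knows w v) => [->|]; rewrite ?leq_b1.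
  (* The isolated emitter depends on [a] and [t] only, so any history of length [t] identifies it
     for all of them. *)
  have [w0 w0t] : exists w : seq choices, size w = t.
    have /card_gt0P[x _] := choices_gt0.
    by exists (nseq t x); rewrite size_nseq.
  have odw0 : odd (size w0) by rewrite w0t.
  have [u [uf em _]] := hear_isolated odw0 dv iso.
  apply: le_trans (_ : 2^-1 * unknown t v + 2^-1 * unknown t u <= _).
    rewrite -!expectZ -expectD; apply: expect_le => w wt.
    have odw : odd (size w) by rewrite wt.
    have [u' [uf' em' hE]] := hear_isolated odw dv iso.
    suff <- : u' = u by exact: avg_isolated.
    have /andP[_ /cards1P[z zE]] := iso.
    have inz x : x \in feeders v -> emits a t x -> x = z.
      move=> xf; rewrite /emits odt => /andP[_ xa].
      by apply/set1P; rewrite -zE inE xf.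
    rewrite wt in em'; rewrite w0t in em.
    by rewrite (inz _ uf' em') (inz _ uf em).
  by have := ug _ uf; rewrite -/p mulr1; lra.
rewrite avgD avg_cst ?avgZ; last first.
  apply/card_gt0P.
  by exists (ord0, @ord0 (trunc_log 2 n), [ffun=> Ordinal (expn_gt0 2 h.+1)]).
have := avg_isolates dv fne; rewrite -/th; nra.
Qed.

Lemma launch_window v t : exists2 t1, launch v t1 & (t <= t1 < t + 6 * h)%N.
Proof.
pose c := (lev (head v) + 3 * rk (head v))%N; pose q := (3 * h)%N.
have q0 : (0 < q)%N by rewrite muln_gt0.
(* The multiple [q * uphalf t] vanishes modulo [q] and keeps the subtraction from truncating. *)
pose a := ((c + q * uphalf t - uphalf t) %% q)%N.
have aq : (a < q)%N by rewrite ltn_mod.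
have tq : (uphalf t <= q * uphalf t)%N by rewrite leq_pmull.
exists (uphalf t + a).*2; last first.
  move: aq; rewrite /q -!addnn uphalf_half.
  by rewrite -[X in (X <= _ < X + _)%N]odd_double_half; lia.
rewrite /launch /wavefront odd_double doubleK -/c -/q /a; apply/eqP.
rewrite modnDmr -(addnBA _ tq) addnCA subnKC //.
by rewrite addnC mulnC modnMDl.
Qed.

(** Waves for [v] start every [6 * h] rounds; one whose head knows the difference carries distinct
    bits with probability 1/2. *)
Lemma fast_step t v : fast v ->
  unserved (t + 6 * h) v <= 2^-1 * unserved t v + 2^-1 * unknown t (head v).
Proof.
move=> fv; have [t1 lau /andP[tt1 t1t]] := launch_window v t.
have := unserved_mono v tt1; have := unknown_mono (head v) tt1.
have := unserved_mono v t1t.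
suff : unserved t1.+1 v <= 2^-1 * unserved t1 v + 2^-1 * unknown t1 (head v) by lra.
have [evt wfr] := andP lau.
rewrite /unserved /unknown -!expectZ -expectD /=; apply: expect_le => w wt.
rewrite avg_pair -[X in _ <= X](@avg_cst _ sampling); last first.
  apply/card_gt0P.
  by exists (ord0, @ord0 (trunc_log 2 n), [ffun=> Ordinal (expn_gt0 2 h.+1)]).
apply: avg_le => a /=; rewrite wt lau /=.
have [sv|nsv] := boolP (served w v).
  rewrite (@eq_avg _ _ _ (fun=> 0)) //.
  rewrite avg_cst; last by apply/card_gt0P; exists [ffun=> false].
  by rewrite mulr0 add0r mulr_ge0 ?invr_ge0 ?ler0n.
rewrite mulr1 /=; under eq_avg do rewrite negbK.
apply: avg_coding; last by rewrite fast_head orbT.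
by rewrite /emits wt (negPf evt) wfr head_fast_child.
Qed.

Definition shortcut v := fast v && (vdist v == (vdist (head v)).+1).

(* A vertex reached through a shortcut is accounted for when its head emits
   the packet, [delay v] rounds before the packet arrives. *)
Definition delay v := if shortcut v then (2 * (lev v - lev (head v)))%N else 0%N.
Definition pending t v := if shortcut v then unserved t v else unknown t v.
(** A feeder is one virtual step closer but may be one level deeper; equal weights on [lev] and
    [vdist] ensure that it is ready no later than [v]. *)
Definition start v := (2 * lev v + 2 * vdist v - delay v)%N.

Lemma delay_start v : (delay v + start v = 2 * lev v + 2 * vdist v)%N.
Proof. by rewrite /start /delay; case: ifP; lia. Qed.

Lemma unknown_pending t v : unknown (delay v + t) v <= pending t v.
Proof.
rewrite /delay /pending; case: ifP => // /andP[fv _].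
exact: unknown_unserved.
Qed.

(** Put [e = 1 / (192 * h)]. The feeders' bound is half that of [v], so [slow_step] multiplies the
    latter by [1 - 2 * e <= (1 - e) ^ 2], which is the decay needed for two rounds. *)
Let rate : R := 1 - (192 * h)%:R^-1.

Lemma rate_itv : 0 <= ((192 * h)%:R^-1 : R) <= 1.
Proof. by rewrite invr_ge0 ler0n invf_le1 ?ler1n ?ltr0n muln_gt0. Qed.

Lemma rate_ge0 : 0 <= rate.
Proof. by rewrite subr_ge0; case/andP: rate_itv. Qed.

Lemma rate_le1 : rate <= 1.
Proof. by have /andP[? _] := rate_itv; rewrite /rate; lra. Qed.

Lemma rate_window x : (x <= 6 * h)%N -> 3 / 4 <= rate ^+ x.
Proof.
move=> xh; apply: le_trans (_ : rate ^+ (6 * h) <= _); last first.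
  by apply: ler_wiXn2l xh; rewrite ?rate_ge0 ?rate_le1.
apply: le_trans (bernoulli_sub _ rate_itv).
have h0 : h%:R != 0 :> R by rewrite pnatr_eq0.
have -> : (6 * h)%:R * (192 * h)%:R^-1 = 32^-1 :> R.
  by rewrite !natrM; field.
by lra.
Qed.

Lemma pending_le1 t v : pending t v <= 1.
Proof. by rewrite /pending; case: ifP => _; exact: expect_bool_le1. Qed.

(** Induction on [vdist v], then on [x]. For a shortcut, a window of [6 * h] rounds gives the factor
    1/2 + 1/4, which is at most [rate ^+ (6 * h)]; otherwise an odd round among two gives
    [rate ^+ 2]. For small [x] the right side exceeds 1. *)
Lemma pending_bound v x : pending (start v + x) v <= 2 ^+ vdist v * rate ^+ x.
Proof.
have [d] := ubnP (vdist v); elim: d v x => // d IHd v x; rewrite ltnS => dv.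
have [->|vs] := eqVneq v s.
  rewrite /pending /shortcut /fast eqxx /= /unknown.
  rewrite (@eq_expect _ _ _ _ (fun=> 0)) => [|w _]; last by rewrite /knows eqxx.
  by rewrite expect_cst ?choices_gt0 // mulr_ge0 ?exprn_ge0 ?rate_ge0.
have vd0 : (0 < vdist v)%N by rewrite lt0n (hops_eq0 vconn).
have base y : (y <= 6 * h)%N -> 1 <= 2 ^+ vdist v * rate ^+ y.
  move=> /rate_window ry; have : 2 <= 2 ^+ vdist v :> R.
    by rewrite -[X in X <= _]expr1 ler_eXn2l ?ltr1n.
  by move: (2 ^+ _) (rate ^+ y) ry => p q *; nra.
have feed u y : (delay u + start u <= start v)%N -> vdist v = (vdist u).+1 ->
    unknown (start v + y) u <= 2^-1 * (2 ^+ vdist v * rate ^+ y).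
  move=> le dE; apply: le_trans (_ : 2 ^+ vdist u * rate ^+ y <= _); last first.
    by rewrite dE exprS mulrA mulKf // pnatr_eq0.
  apply: le_trans (IHd u y _); last by rewrite -dE.
  apply: le_trans (unknown_pending _ _); apply: unknown_mono.
  by rewrite addnA leq_add2r.
have gpos y : 0 <= 2 ^+ vdist v * rate ^+ y by rewrite mulr_ge0 ?exprn_ge0 ?rate_ge0.
have [sv|nsv] := boolP (shortcut v).
  have [fv /eqP dE] := andP sv.
  have startE : start v = (2 * lev (head v) + 2 * vdist v)%N.
    by rewrite /start /delay sv; have := lev_head v; lia.
  have [l] := ubnP x; elim: l x => // l IHl x; rewrite ltnS => xl.
  have [x6|x6] := leqP x (6 * h); first exact: le_trans (pending_le1 _ _) (base _ x6).
  have h0 : (0 < h)%N by [].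
  have {IHl} := IHl (x - 6 * h)%N (ltac:(by lia)).
  set y := (x - 6 * h)%N => IHy; have xE : x = (y + 6 * h)%N by lia.
  rewrite xE addnA /pending sv; apply: le_trans (fast_step _ fv) _.
  have fe := feed (head v) y (ltac:(by rewrite delay_start startE; lia)) dE.
  rewrite /pending sv in IHy; rewrite exprD mulrA.
  have := rate_window (leqnn (6 * h)); have := gpos y.
  move: (2 ^+ _ * _) (rate ^+ (6 * h)) IHy fe => p q *; nra.
have startE : start v = (2 * lev v + 2 * vdist v)%N.
  by rewrite /start /delay (negPf nsv) subn0.
have feederP u : u \in feeders v ->
    (delay u + start u <= start v)%N /\ vdist v = (vdist u).+1.
  rewrite inE => /andP[Gvu /eqP dE]; rewrite delay_start startE.
  by have := lev_edge Gvu; lia.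
(* A virtual predecessor reached through a shortcut edge would make [v] a shortcut vertex, so the
   predecessor is a neighbor in [G]. *)
have fne : feeders v != set0.
  have [u euv dE] := hops_pred vconn vs; apply/set0Pn; exists u.
  rewrite inE /vdist dE eqxx andbT adj_sym; case/orP: euv => // /andP[fv /eqP uE].
  by move: nsv; rewrite /shortcut fv -uE /vdist dE eqxx.
have [l] := ubnP x; elim: l x => // l IHl x; rewrite ltnS => xl.
have h0 : (0 < h)%N by [].
have [x2|x2] := ltnP x 2.
  by apply: le_trans (pending_le1 _ _) (base _ _); lia.
have {IHl} := IHl (x - 2)%N (ltac:(by lia)).
set y := (x - 2)%N => IHy; have xE : x = (y + 2)%N by lia.
rewrite /pending (negPf nsv) in IHy *.
have [t odt /andP[tge tlt]] : exists2 t, odd t & (start v + y <= t < start v + x)%N.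
  case odd_sy: (odd (start v + y)); first by exists (start v + y)%N; lia.
  by exists (start v + y).+1; rewrite /= ?odd_sy //; lia.
apply: le_trans (unknown_mono v tlt) _.
have := slow_step (g := 2^-1 * (2 ^+ vdist v * rate ^+ y)) odt vd0 fne _ _
  (le_trans (unknown_mono v tge) IHy).
have gy := gpos y; move=> step.
apply: le_trans (step _ _) _.
- move=> u uf; have [le dE] := feederP _ uf.
  exact: le_trans (unknown_mono u tge) (feed u y le dE).
- by move: (2 ^+ _ * _) gy => p; lra.
rewrite xE exprD mulrA expr2 /rate; move: (2 ^+ _ * _) gy => p gy.
have -> : (48 * h%:R)^-1 = 4 * (192 * h)%:R^-1 :> R.
  have hn0 : h%:R != 0 :> R by rewrite pnatr_eq0.
  by rewrite natrM; field.
have /andP[e0 _] := rate_itv; move: (_^-1) e0 => e e0.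
have pee : 0 <= p * (e * e) by rewrite !mulr_ge0.
lra.
Qed.

Lemma unknown_bound v D K : (lev v <= D)%N ->
  unknown (2 * D + 4 * h + 192 * h * K) v <= 2 ^+ (2 * h) * 2^-1 ^+ K.
Proof.
move=> levD; set x := (192 * h * K)%N.
apply: le_trans (_ : unknown (delay v + (start v + x)) v <= _).
  by apply: unknown_mono; rewrite addnA delay_start; have := vdist_lt v; lia.
apply: le_trans (unknown_pending _ _) _; apply: le_trans (pending_bound _ _) _.
apply: ler_pM; rewrite ?exprn_ge0 ?rate_ge0 //.
  by rewrite ler_eXn2l ?ltr1n // ltnW // vdist_lt.
rewrite /x exprM lerXn2r // ?nnegrE ?exprn_ge0 ?rate_ge0 ?invr_ge0 //.
by rewrite /rate exp_one_minus_inv // muln_gt0.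
Qed.

End Pair.

(** Union bound: at most [2 ^ (2 * K + h)] triples of a node and two messages, each failing with
    probability at most [2 ^ (2 * h)] times [2 ^ -(2 * K + 3 * h + 1)], give a total of at most
    1/2. *)
Lemma good_choices K D : #|M| <= 2 ^ K -> (forall v, lev v <= D) ->
  exists2 w : seq choices,
    size w = 2 * D + 4 * h + 192 * h * (2 * K + 3 * h).+1
  & forall v m m', m != m' -> knows m m' w v.
Proof.
move=> MK levD; pose T := 2 * D + 4 * h + 192 * h * (2 * K + 3 * h).+1.
pose bad w : rat := (\sum_v \sum_(p : M * M) (if p.1 == p.2 then 0 else
   (~~ knows p.1 p.2 w v)%:R))%R.
have [||w wT lt1] := @expect_lt1 rat choices _ T bad; first exact: choices_gt0.
  pose b : rat := (2 ^+ (2 * h) * 2^-1 ^+ (2 * K + 3 * h).+1)%R.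
  have b0 : (0 <= b)%R by rewrite mulr_ge0 // exprn_ge0 // invr_ge0.
  apply: (@le_lt_trans _ _ (\sum_(v < n) \sum_(p : M * M) b)%R).
    rewrite expect_sum; apply: ler_sum => v _; rewrite expect_sum.
    apply: ler_sum => -[m m'] _ /=; have [_|mm'] := eqVneq m m'.
      by rewrite expect_cst // choices_gt0.
    exact: unknown_bound.
  rewrite !sumr_const card_prod card_ord -mulrnA -mulr_natl.
  apply: (@le_lt_trans _ _ ((2 ^ (2 * K + h))%:R * b)%R).
    rewrite ler_wpM2r // ler_nat mulnC addnC expnD mul2n -addnn expnD.
    by rewrite leq_mul ?leq_mul // ltnW // trunc_log_ltn.
  rewrite /b natrX mulrA -exprD.
  have -> : 2 * K + h + 2 * h = 2 * K + 3 * h by lia.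
  by rewrite exprSr mulrA -exprMn mulfV // expr1n mul1r.
exists w => // v m m' mm'; apply: contraTT lt1 => nk; rewrite -leNgt.
have ge0 u (p : M * M) : (0 <= (if p.1 == p.2 then 0 else
   (~~ knows p.1 p.2 w u)%:R) :> rat)%R by case: ifP; rewrite ?ler0n.
rewrite /bad (bigD1 v) //= (bigD1 (m, m')) //= (negPf mm') nk -addrA lerDl.
by rewrite addr_ge0 ?sumr_ge0 // => u _; rewrite sumr_ge0.
Qed.

(** * The protocol *)

Section Protocol.
Variables (k B : nat) (enc : k.-tuple message -> 'I_B -> M).
Variable valid : k.-tuple message -> Prop.
Hypothesis enc_inj : forall m m', valid m -> valid m' -> enc m =1 enc m' -> m = m'.
Variable w : seq choices.
Hypothesis w_good : forall v m m', m != m' -> knows m m' w v.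

Definition track (b : 'I_B) (hist : seq (reception B)) : seq (option bool) :=
  [seq omap (fun p : packet B => tnth p b) o | o <- hist].

(** A packet carries one bit of each of [B] copies of the one-bit scheme. Whether a node transmits
    does not depend on the messages, so the copies share the choices [w]. As [w] lists the latest
    round first, the current choice heads its last [size hist + 1] entries. *)
Definition coded_act (u : 'I_n) (inp : option (k.-tuple message))
    (_ : 0.-tuple bool) (hist : seq (reception B)) : option (packet B) :=
  if drop (size w - (size hist).+1) w is x :: past then
    if emits x.1 (size past) u then
      Some [tuple odflt false (emit x (size past) (heard past ^~ u) u
                                 (omap (enc^~ b) inp) (track b hist)) | b < B]
    else None
  else None.

Definition consistent v (hist : seq (reception B)) (m : k.-tuple message) : Prop :=
  valid m /\ forall b, heard w (enc m b) v = track b hist.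

Definition coded_output (v : 'I_n) (inp : option (k.-tuple message))
    (_ : 0.-tuple bool) (hist : seq (reception B)) : k.-tuple message :=
  if inp is Some m then m
  else if pselect (exists m, consistent v hist m) is left e then projT1 (cid e)
  else [tuple of nseq k [::]].

Definition coded_protocol : protocol n k B :=
  Protocol (size w) coded_act coded_output.

Lemma coded_history m (om : coin_space coded_protocol) t v b : t <= size w ->
  size (history G s m om t v) = t /\
  track b (history G s m om t v) = heard (drop (size w - t) w) (enc m b) v.
Proof.
elim: t v b => [|t IHt] v b tw /=; first by rewrite subn0 drop_size.
rewrite size_rcons (IHt v b (ltnW tw)).1; split=> //.
rewrite /track map_rcons -/(track b _) (IHt v b (ltnW tw)).2.
case E: (drop (size w - t.+1) w) => [|x past].
  by have := congr1 size E; rewrite size_drop subKn.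
have pastE : drop (size w - t) w = past.
  by rewrite -(subnSK tw) -add1n -drop_drop E /= drop0.
rewrite pastE heard_cons; congr rcons.
rewrite -/(hear G (fun u => coded_act u (input s m u) (om u) (history G s m om t u)) v).
rewrite hear_map; apply: eq_hear => u; rewrite /coded_act.
have [sz tr] := IHt u b (ltnW tw); rewrite sz E /sent.
have [em|nem] := ifP; last by rewrite /= /emit nem.
rewrite /= tnth_mktuple tr pastE.
have -> : omap (enc^~ b) (input s m u) = source_input (enc m b) u.
  by rewrite /input /source_input; case: eqP.
by rewrite /emit em.
Qed.

(** The true vector is consistent with its own history. Another valid vector differs from it in some
    slice, and [w] separates that slice at every node. *)
Lemma coded_delivered m (om : coin_space coded_protocol) :
  valid m -> delivered G s m om.
Proof.
move=> vm; apply/forallP => v; apply/eqP; rewrite /= /coded_output /input.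
have [//|vs] := eqVneq v s.
have tr b := (coded_history m om v b (leqnn (size w))).2.
rewrite subnn drop0 in tr.
case: pselect => [e|nex]; last by case: nex; exists m; split=> // b; rewrite tr.
have [vm1 hm1] := projT2 (cid e); apply: enc_inj => // b.
apply/eqP; apply: contraT => /(w_good v); rewrite /knows (negPf vs) /=.
by rewrite hm1 tr eqxx.
Qed.

End Protocol.
End Schedule.

(** * Encoding of message vectors by bits *)

Section Encoding.
Variables (k B q : nat).

(* Bit b of the chunks of B bits into which the messages are cut; the bit true
   appended to each message marks its end in the padding. *)
Definition bit_slice (m : k.-tuple message) (b : 'I_B) :
    {ffun 'I_k * 'I_q.+1 -> bool} :=
  [ffun p : 'I_k * 'I_q.+1 => nth false (rcons (tnth m p.1) true) (p.2 * B + b)].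

(** At the end marker of the longer word, a shorter one already shows padding. *)
Lemma nth_rcons_true_inj (s1 s2 : message) :
  (forall j, nth false (rcons s1 true) j = nth false (rcons s2 true) j) ->
  s1 = s2.
Proof.
wlog le : s1 s2 / size s1 <= size s2.
  by move=> H E; have [/H->//|/ltnW/H->//] := leqP (size s1) (size s2).
move=> E; have szE : size s1 = size s2.
  apply/eqP; rewrite eqn_leq le leqNgt; apply/negP => lt.
  have := E (size s2); rewrite !nth_rcons ltnn eqxx.
  by rewrite ltnNge le /= gtn_eqF.
apply: (@eq_from_nth _ false) => // j js; have := E j.
by rewrite !nth_rcons -szE js.
Qed.

(** The extra chunk in [q.+1] leaves room for the end marker of a message of full length [q * B]. *)
Lemma bit_slice_inj (m m' : k.-tuple message) : 0 < B ->
  (forall i, size (tnth m i) <= q * B) -> (forall i, size (tnth m' i) <= q * B) ->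
  bit_slice m =1 bit_slice m' -> m = m'.
Proof.
move=> B0 sm sm' E; apply: eq_from_tnth => i; apply: nth_rcons_true_inj => j.
have [jlt|jge] := ltnP j (q.+1 * B); last first.
  by rewrite !nth_default // size_rcons; [have := sm' i|have := sm i]; lia.
have jq : j %/ B < q.+1 by rewrite ltn_divLR.
have jb : j %% B < B by rewrite ltn_mod.
have /ffunP/(_ (i, Ordinal jq)) := E (Ordinal jb).
by rewrite !ffunE /= -divn_eq.
Qed.

End Encoding.

Lemma broadcast_protocol n (G : graph n) (s : 'I_n) (k B q : nat) :
  connected G -> 0 < B ->
  let h := (trunc_log 2 n).+1 in
  exists P : protocol n k B,
    rounds P = 2 * diameter G + 4 * h + 192 * h * (2 * (k * q.+1) + 3 * h).+1 /\
    forall (m : k.-tuple message), (forall i, size (tnth m i) <= q * B) ->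
      forall om : coin_space P, delivered G s m om.
Proof.
move=> conn B0 h; have [par [rk tree]] := ranked_tree s conn.
have cM : #|{ffun 'I_k * 'I_q.+1 -> bool}| <= 2 ^ (k * q.+1).
  by rewrite card_ffun card_bool card_prod !card_ord.
have [w ws w_good] := good_choices conn tree cM (hops_le_diameter G s).
exists (coded_protocol G s par rk (@bit_slice k B q)
  (fun m => forall i, size (tnth m i) <= q * B) w).
split=> // m vm om; apply: coded_delivered => // m1 m2 v1 v2.
exact: bit_slice_inj.
Qed.


(** * The round count in terms of [ln n] *)

Lemma round_count_le D K h : 0 < h ->
  2 * D + 4 * h + 192 * h * (2 * K + 3 * h).+1
    <= 2 * D + 384 * (K * h) + 772 * (h * h).
Proof. by move=> h0; have hh : h <= h * h by [rewrite leq_pmulr]; lia. Qed.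

Local Open Scope ring_scope.

Definition silent_protocol n k B : protocol n k B :=
  @Protocol n k B 0 0 (fun _ _ _ _ => None) (fun _ _ _ _ => [tuple of nseq k [::]]).

Theorem theorem2 (R : realType) (a b c : R)
    (ha : 0 < a) (hb : 0 < b) (hc : 1 <= c) :
  exists (C : R) (A : algorithm), 0 < C /\
    forall (n : nat) (G : graph n) (s : 'I_n) (k B : nat),
      connected G ->
      b * ln n%:R <= B%:R ->
      (rounds (A n G s k B))%:R
        <= C * ((diameter G)%:R + k%:R * ln n%:R + ln n%:R ^+ 2) /\
      forall m : k.-tuple message,
        (forall i, (size (tnth m i))%:R <= a * B%:R) ->
        1 - (n%:R `^ c)^-1 <= success_probability R G s (A n G s k B) m.
Proof.
have [q aq] : exists q : nat, a <= q%:R.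
  by exists (Num.bound a); rewrite ltW // archi_boundP // ltW.
pose spec n (G : graph n) s k B (P : protocol n k B) :=
  let h := (trunc_log 2 n).+1 in
  rounds P = (2 * diameter G + 4 * h + 192 * h * (2 * (k * q.+1) + 3 * h).+1)%N /\
  forall m : k.-tuple message, (forall i, (size (tnth m i) <= q * B)%N) ->
    forall om : coin_space P, delivered G s m om.
(* Known topology allows the protocol to be picked by classical choice for each graph and all
   parameters. *)
pose A : algorithm := fun n G s k B =>
  if (n <= 1)%N then silent_protocol n k B
  else if pselect (exists P, @spec n G s k B P) is left e then projT1 (cid e)
  else silent_protocol n k B.
have ln2 : 0 < ln 2 :> R by rewrite ln_gt0 // ltr1n.
(* Chosen so that [h <= lam * ln n] for [n >= 2]: both [trunc_log 2 n] and 1 are at most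
   [ln n / ln 2]. *)
pose lam : R := 2 / ln 2; have lam0 : 0 < lam by rewrite divr_gt0.
pose C : R := 2 + 384 * q.+1%:R * lam + 772 * lam ^+ 2.
have C1 : 0 <= 384 * q.+1%:R * lam by rewrite -natrM mulr_ge0 ?ler0n // ltW.
have C2 : 0 <= 772 * lam ^+ 2 by rewrite mulr_ge0 ?ler0n ?sqr_ge0.
have C0 : 0 < C by rewrite /C; lra.
exists C, A; split=> //.
move=> n G s k B conn bB; have n0 : (0 < n)%N by case: n s {G conn bB} => [[]|].
have l0 : 0 <= ln n%:R :> R by rewrite ln_ge0 // ler1n.
set l := ln n%:R in bB l0 *.
(* For a single node the required probability is 0, so zero rounds do. *)
have [n1|n1] := leqP n 1.
  have -> : A n G s k B = silent_protocol n k B by rewrite /A n1.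
  have nE : n = 1%N by apply/eqP; rewrite eqn_leq n1.
  split=> [|m _]; last first.
    have -> : n%:R = 1 :> R by rewrite nE.
    by rewrite powR1 invr1 subrr divr_ge0.
  apply: mulr_ge0; first exact: ltW.
  by rewrite addr_ge0 ?sqr_ge0 // addr_ge0 // mulr_ge0.
have lpos : 0 < l by rewrite ln_gt0 // ltr1n.
have B0 : (0 < B)%N.
  by rewrite -(ltr0n R); apply: lt_le_trans bB; rewrite mulr_gt0.
have [P [-> [rP dP]]] : exists P, A n G s k B = P /\ spec n G s k B P.
  rewrite /A leqNgt n1 /=; case: pselect => [e|[]].
    by exists (projT1 (cid e)); split=> //; exact: projT2 (cid e).
  exact: broadcast_protocol.
split=> [|m sm]; last first.
  rewrite /success_probability.
  have -> : [set om : coin_space P | delivered G s m om] = [set: coin_space P].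
    apply/setP => om; rewrite !inE dP // => i.
    rewrite -(ler_nat R) natrM; apply: le_trans (sm i) _.
    by rewrite ler_wpM2r.
  rewrite cardsT divff; last first.
    by rewrite pnatr_eq0 -lt0n; apply/card_gt0P; exists [ffun=> [tuple of nseq _ false]].
  by rewrite lerBlDr lerDl invr_ge0 powR_ge0.
set h := (trunc_log 2 n).+1 in rP.
have hl : h%:R <= lam * l.
  have /andP[le_n _] := trunc_log_bounds (isT : (1 < 2)%N) n0.
  have : (trunc_log 2 n)%:R * ln 2 <= l.
    rewrite mulr_natl -lnXn ?ltr0n // ler_ln ?posrE ?exprn_gt0 ?ltr0n //.
    by rewrite -natrX ler_nat.
  have : ln 2 <= l by rewrite ler_ln ?posrE ?ltr0n // ler_nat.
  rewrite /h /lam -natr1 mulrAC ler_pdivlMr //; lra.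
rewrite rP.
have ll0 : 0 <= lam * l by rewrite mulr_ge0 // ltW.
have hh : h%:R ^+ 2 <= lam ^+ 2 * l ^+ 2.
  by rewrite -exprMn lerXn2r // nnegrE ler0n.
have kh : k%:R * q.+1%:R * h%:R <= k%:R * q.+1%:R * (lam * l).
  by rewrite ler_wpM2l // mulr_ge0.
apply: (@le_trans _ _ (2 * (diameter G)%:R + 384 * (k%:R * q.+1%:R * h%:R)
                        + 772 * h%:R ^+ 2)).
  by rewrite expr2 -!natrM -!natrD ler_nat round_count_le.
have D0 : 0 <= (diameter G)%:R :> R by [].
have kl0 : 0 <= k%:R * l :> R by rewrite mulr_ge0.
have l20 : 0 <= l ^+ 2 by rewrite exprn_ge0.
apply: (@le_trans _ _ (2 * (diameter G)%:R + 384 * q.+1%:R * lam * (k%:R * l)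
                        + 772 * lam ^+ 2 * l ^+ 2)).
  by lra.
rewrite /C; move: C1 C2.
move: (384 * _ * lam) (772 * _) (k%:R * l) (l ^+ 2) kl0 l20 (_%:R) D0
  => p1 p2 y z y0 z0 d d0 *.
by rewrite !mulrDl !mulrDr; nra.
Qed.
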